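(* Let $\widehat{\rho}$ be a density matrix on $L^2(\mathbb{R}^n)$ and let $\widehat{A},\widehat{B}$ be two observables (for either the Weyl or the Born--Jordan correspondence) whose variances and covariances with respect to $\widehat\rho$ exist. Then $$(\operatorname{Var}_\rho\widehat{A})^2(\operatorname{Var}_\rho\widehat{B})^2\ \geq\ \operatorname{Cov}_\rho^{\mathrm{sym}}(\widehat{A},\widehat{B})^2-\tfrac14\langle[\widehat{A},\widehat{B}]\rangle_\rho^2,$$ where $\langle[\widehat{A},\widehat{B}]\rangle_\rho^2\le 0$ and $$\operatorname{Cov}_\rho^{\mathrm{sym}}(\widehat{A},\widehat{B})=\tfrac12\big(\operatorname{Cov}_\rho(\widehat{A},\widehat{B})+\operatorname{Cov}_\rho(\widehat{B},\widehat{A})\big)$$ is a real number. In particular the Heisenberg inequality $$(\operatorname{Var}_\rho\widehat{A})^2(\operatorname{Var}_\rho\widehat{B})^2\ \geq\ -\tfrac14\langle[\widehat{A},\widehat{B}]\rangle_\rho^2$$ holds.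
   Context: A density matrix on $L^2(\mathbb{R}^n)$ is a positive self-adjoint trace class operator $\widehat\rho$ with trace $1$; write $\widehat\rho=\sum_{j\ge1}\lambda_j\Pi_{\psi_j}$ with $\lambda_j\geq0$, $\sum_j\lambda_j=1$, $(\psi_j)$ an orthonormal system and $\Pi_{\psi_j}$ the orthogonal projection on $\mathbb{C}\psi_j$. An observable is an operator $\widehat{A}=\operatorname{Op}(a)$ on $L^2(\mathbb{R}^n)$ with real symbol $a\in\mathcal{S}'(\mathbb{R}^{2n})$, considered as an (essentially) self-adjoint operator. Here $\operatorname{Op}$ is one of the following two correspondences ($\hbar>0$ fixed, $z=(x,p)$): Weyl, $\operatorname{Op}(a)\psi=(2\pi\hbar)^{-n}\int_{\mathbb{R}^{2n}} a_\sigma(z)\widehat{T}(z)\psi\,dz$; or Born--Jordan, the same formula with $a_\sigma$ replaced by $a_\sigma\Theta$. In these formulas $a_\sigma(z)=(2\pi\hbar)^{-n}\int e^{-\frac{i}{\hbar}(p\cdot x'-p'\cdot x)}a(z')\,dz'$, $\widehat{T}(z_0)\psi(x)=e^{\frac{i}{\hbar}(p_0\cdot x-\frac12p_0\cdot x_0)}\psi(x-x_0)$ and $\Theta(z)=\frac{\sin(p\cdot x/2\hbar)}{p\cdot x/2\hbar}$ (equal to $1$ where $p\cdot x=0$). For an operator $\widehat{C}$ its expectation value is $\langle\widehat{C}\rangle_\rho=\operatorname{Tr}(\widehat\rho\widehat{C})=\sum_j\lambda_j(\widehat{C}\psi_j|\psi_j)_{L^2}$; it is said to exist when the $\psi_j$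 with $\lambda_j>0$ lie in the domain of $\widehat{C}$ and the series converges absolutely. Existence of the variances and covariances means that the expectation values of $\widehat{A},\widehat{B},\widehat{A}^2,\widehat{B}^2,\widehat{A}\widehat{B},\widehat{B}\widehat{A}$ exist. One sets $$(\operatorname{Var}_\rho\widehat{A})^2=\operatorname{Tr}(\widehat\rho\widehat{A}^2)-\operatorname{Tr}(\widehat\rho\widehat{A})^2,\qquad \operatorname{Cov}_\rho(\widehat{A},\widehat{B})=\operatorname{Tr}(\widehat\rho\widehat{A}\widehat{B})-\operatorname{Tr}(\widehat\rho\widehat{A})\operatorname{Tr}(\widehat\rho\widehat{B}),$$ so that $\operatorname{Var}_\rho$ denotes the standard deviation and its square the variance. $[\widehat{A},\widehat{B}]=\widehat{A}\widehat{B}-\widehat{B}\widehat{A}$, and $\langle\cdot\rangle_\rho^2$ denotes the (complex) square of $\langle\cdot\rangle_\rho$. *)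

(* Defs.v *)
From HB Require Import structures.
From mathcomp Require Import all_boot all_order all_algebra.
From mathcomp Require Import complex.
From mathcomp Require Import all_classical all_reals all_analysis.

Set Implicit Arguments.
Unset Strict Implicit.
Unset Printing Implicit Defensive.

Import Order.TTheory GRing.Theory Num.Theory.
Import numFieldNormedType.Exports.

Local Open Scope classical_set_scope.
Local Open Scope ring_scope.
Local Open Scope complex_scope.

Local Notation Re := complex.Re.
Local Notation Im := complex.Im.

Definition rV_display : measure_display.
Proof. exact: default_measure_display. Qed.

Section rV_measurable.
Context {R : realType}.
Variable n : nat.

Definition rV_coord (i : 'I_n) (x : 'rV[R]_n) : measurableTypeR R := x 0 i.

Let rV_set0 : g_sigma_preimage rV_coord set0.
Proof. exact: sigma_algebra0. Qed.

Let rV_setC A : g_sigma_preimage rV_coord A -> g_sigma_preimage rV_coord (~` A).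
Proof. exact: sigma_algebraC. Qed.

Let rV_bigcup (F : _^nat) : (forall i, g_sigma_preimage rV_coord (F i)) ->
  g_sigma_preimage rV_coord (\bigcup_i (F i)).
Proof. exact: sigma_algebra_bigcup. Qed.

(* the sigma-algebra generated by the coordinates, i.e. the Borel sets of R^n *)
HB.instance Definition _ := @isMeasurable.Build rV_display
  'rV[R]_n (g_sigma_preimage rV_coord) rV_set0 rV_setC rV_bigcup.

End rV_measurable.

Section lebesgue_rV.
Context {R : realType}.

Lemma measurable_rV_coord n (i : 'I_n) :
  measurable_fun [set: 'rV[R]_n] (rV_coord i).
Proof.
move=> _ Y mY; rewrite setTI; apply: sub_sigma_algebra => /=.
rewrite -bigcup_seq/=; exists i => /=; first by rewrite mem_index_enum.
by exists Y => //; rewrite setTI.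
Qed.

Lemma measurable_fun_rVP d (T : measurableType d) n (f : T -> 'rV[R]_n) :
  (forall i, measurable_fun [set: T] (rV_coord i \o f)) ->
  measurable_fun [set: T] f.
Proof.
move=> mf; suff prefS : g_sigma_preimage (fun i => @rV_coord R n i \o f)
    `<=` measurable.
  by rewrite g_sigma_preimage_comp in prefS => _ A mA; apply: prefS; exists A.
apply: smallest_sub; first exact: sigma_algebra_measurable.
case: n => [|n] in f mf *; first by rewrite big_ord0.
rewrite -bigcup_mkord_ord; apply: bigcup_sub => i Ii.
by move=> A [B mB <-]; exact: mf.
Qed.

Definition rV_cons n (u : 'rV[R]_n * measurableTypeR R) : 'rV[R]_n.+1 :=
  row_mx (u.2 : R)%:M u.1 : 'rV[R]_(1 + n).

Lemma measurable_rV_cons n : measurable_fun setT (@rV_cons n).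
Proof.
apply: measurable_fun_rVP => i; rewrite /rV_coord /rV_cons.
have [j ij|j ij] := @split_ordP 1 n i.
- rewrite (_ : _ \o _ = snd); first exact: measurable_snd.
  by apply/funext => -[v t]; rewrite ij; apply: etrans (row_mxEl _ _ _ _) _;
    rewrite ord1 mxE eqxx mulr1n.
- rewrite (_ : _ \o _ = rV_coord j \o fst).
    exact: measurableT_comp (measurable_rV_coord j) measurable_fst.
  by apply/funext => u; rewrite ij; apply: etrans (row_mxEr _ _ _ _) _.
Qed.

Section lebesgue_rV_succ.
Variables (n : nat) (mu : {measure set 'rV[R]_n -> \bar R}).
Let mcons := @measurable_rV_cons n.

Definition lebesgue_rV_succ (A : set 'rV[R]_n.+1) : \bar R :=
  pushforward (mu \x @lebesgue_measure R)%E (@rV_cons n) A.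

HB.instance Definition _ := Measure.copy lebesgue_rV_succ
  (measure_function_pushforward__canonical__measure_function_Measure
     (mu \x @lebesgue_measure R)%E mcons).

End lebesgue_rV_succ.

Fixpoint lebesgue_rV n : {measure set 'rV[R]_n -> \bar R} :=
  match n with
  | 0 => \d_(0 : 'rV[R]_0)
  | m.+1 => lebesgue_rV_succ (lebesgue_rV m)
  end.

End lebesgue_rV.

Lemma lebesgue_rV_box (R : realType) n (A : 'I_n -> set R) :
  (forall i, measurable (A i : set (measurableTypeR R))) ->
  lebesgue_rV n [set x : 'rV[R]_n | forall i, A i (x 0 i)] =
  (\prod_(i < n) @lebesgue_measure R (A i))%E.
Proof.
elim: n A => [A _|n IHn A mA].
  by rewrite big_ord0 /= /dirac indicE mem_set// => -[].
have mB : measurable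
    [set x : 'rV[R]_n | forall i, A (lift ord0 i) (x 0 i)].
  rewrite (_ : mkset _ = \bigcap_(i in [set: 'I_n])
      (rV_coord i @^-1` (A (lift ord0 i)))); last first.
    by apply/seteqP; split => [x Ax i _|x Ax i]; [exact: Ax|exact: (Ax i I)].
  apply: fin_bigcap_measurable => // i _; rewrite -[X in measurable X]setTI.
  exact: measurable_rV_coord.
rewrite big_ord_recl muleC -IHn// -product_measure1E//.
congr (product_measure1 _ _ _); apply/seteqP; split => -[v t] /=.
- move=> Avt; split => [i|].
    have := Avt (lift ord0 i); rewrite /rV_cons.
    rewrite (_ : lift ord0 i = rshift 1 i); last exact/val_inj.
    by rewrite (row_mxEr (t : R)%:M v).
  have := Avt (lshift n (@ord0 0)); rewrite /rV_cons.
  rewrite (row_mxEl (t : R)%:M v) mxE eqxx mulr1n.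
  by rewrite (_ : lshift n ord0 = ord0)//; exact/val_inj.
- move=> [Av At] i; rewrite /rV_cons; case: (@split_ordP 1 n i) => j ->.
    rewrite (row_mxEl (t : R)%:M v) !ord1 mxE eqxx mulr1n.
    by rewrite (_ : lshift n ord0 = ord0)//; exact/val_inj.
  rewrite (row_mxEr (t : R)%:M v) (_ : rshift 1 j = lift ord0 j)//; exact/val_inj.
Qed.

(* An element of L^2(R^n) is represented by a square-integrable function, up to
   equality almost everywhere [eqae]; the notions below are invariant under it. *)

Section L2.
Context {R : realType}.

Definition cintegral n (f : 'rV[R]_n -> R[i]) : R[i] :=
  (\int[lebesgue_rV n]_x Re (f x)) +i* (\int[lebesgue_rV n]_x Im (f x)).

Variable n : nat.
Implicit Types f g : 'rV[R]_n -> R[i].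

Definition L2 : set ('rV[R]_n -> R[i]) := [set f |
  ((fun x => Re (f x)) \in Lfun (lebesgue_rV n) 2%:E) /\
  ((fun x => Im (f x)) \in Lfun (lebesgue_rV n) 2%:E)].

Definition eqae f g := {ae lebesgue_rV n, forall x, f x = g x}.

Definition inner f g : R[i] := cintegral (fun x => f x * (g x)^*).

Definition L2norm f : R := Num.sqrt (Re (inner f f)).

Definition L2dense (D : set ('rV[R]_n -> R[i])) :=
  forall f (e : R), L2 f -> 0 < e ->
    exists g, [/\ L2 g, D g & L2norm (f \- g) < e].

Definition orthonormal (u : nat -> 'rV[R]_n -> R[i]) :=
  (forall j, L2 (u j)) /\ forall i j, inner (u i) (u j) = (i == j)%:R.

Definition orthonormal_basis (u : nat -> 'rV[R]_n -> R[i]) :=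
  orthonormal u /\
  forall f, L2 f ->
    (fun N => L2norm (f \- (fun x => \sum_(j < N) inner f (u j) * u j x)))
      @ \oo --> (0 : R).

End L2.

Section operators.
Context {R : realType}.
Variable n : nat.

(* [act] is only meaningful on [dom]. *)
Record operator := Operator {
  dom : set ('rV[R]_n -> R[i]) ;
  act : ('rV[R]_n -> R[i]) -> 'rV[R]_n -> R[i] }.

Definition linear_operator (A : operator) :=
  [/\ dom A `<=` @L2 R n,
      forall f, dom A f -> L2 (act A f),
      forall f g, dom A f -> L2 g -> eqae f g ->
        dom A g /\ eqae (act A f) (act A g),
      dom A (fun=> 0) &
      forall (c : R[i]) f g, dom A f -> dom A g ->
        dom A (fun x => c * f x + g x) /\
        eqae (act A (fun x => c * f x + g x))
             (fun x => c * act A f x + act A g x)].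

Definition oproduct (A B : operator) : operator :=
  Operator (dom B `&` [set f | dom A (act B f)]) (fun f => act A (act B f)).

Definition commutator (A B : operator) : operator :=
  Operator (dom (oproduct A B) `&` dom (oproduct B A))
    (fun f => act (oproduct A B) f \- act (oproduct B A) f).

(* Adjoints and closures are taken in the sense of linear relations, since the
   adjoint of an operator is single-valued only when its domain is dense. *)
Definition graph (A : operator) : set (('rV[R]_n -> R[i]) * ('rV[R]_n -> R[i])) :=
  [set u | [/\ dom A u.1, L2 u.2 & eqae u.2 (act A u.1)]].

Definition adjoint (G : set (('rV[R]_n -> R[i]) * ('rV[R]_n -> R[i]))) :
    set (('rV[R]_n -> R[i]) * ('rV[R]_n -> R[i])) :=
  [set u | [/\ L2 u.1, L2 u.2 &
    forall v, G v -> inner v.2 u.1 = inner v.1 u.2]].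

Definition gclosure (G : set (('rV[R]_n -> R[i]) * ('rV[R]_n -> R[i]))) :
    set (('rV[R]_n -> R[i]) * ('rV[R]_n -> R[i])) :=
  [set u | [/\ L2 u.1, L2 u.2 & forall e : R, 0 < e ->
    exists2 v, G v & L2norm (u.1 \- v.1) < e /\ L2norm (u.2 \- v.2) < e]].

Definition self_adjoint (A : operator) :=
  [/\ linear_operator A, L2dense (dom A) & graph A = adjoint (graph A)].

Definition essentially_self_adjoint (A : operator) :=
  [/\ linear_operator A, L2dense (dom A) &
      gclosure (graph A) = adjoint (gclosure (graph A))].

Definition bounded_operator (A : operator) :=
  [/\ linear_operator A, dom A = @L2 R n &
      exists M : R, forall f, L2 f -> L2norm (act A f) <= M * L2norm f].

(* For a positive operator, the series of the nonnegative numbers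
   (rho e_k | e_k) over an orthonormal basis converges if and only if rho is
   trace class, and its sum is then the trace. *)
Definition density_matrix (rho : operator) :=
  [/\ bounded_operator rho, self_adjoint rho,
      forall f, L2 f -> 0 <= inner (act rho f) f &
      forall e, orthonormal_basis e ->
        (\sum_(0 <= k <oo) (Re (inner (act rho (e k)) (e k)))%:E = 1)%E].

(* rho = sum_j lam_j Pi_(psi_j), with indices starting at 0. *)
Definition spectral_decomposition (rho : operator)
    (lam : nat -> R) (psi : nat -> 'rV[R]_n -> R[i]) :=
  [/\ forall j, 0 <= lam j,
      series lam @ \oo --> (1 : R),
      orthonormal psi &
      forall f, L2 f ->
        (fun N => L2norm (act rho f \-
           (fun x => \sum_(j < N) (lam j)%:C * inner f (psi j) * psi j x)))
          @ \oo --> (0 : R)].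

Section expectation.
Variables (lam : nat -> R) (psi : nat -> 'rV[R]_n -> R[i]).

Definition qexpectation_term (C : operator) (j : nat) : R[i]^o :=
  (lam j)%:C * inner (act C (psi j)) (psi j).

Definition qexpectation_exists (C : operator) :=
  (forall j, 0 < lam j -> dom C (psi j)) /\
  cvgn [normed series (qexpectation_term C)].

Definition qexpectation (C : operator) : R[i] :=
  limn (series (qexpectation_term C)).

(* the square of the standard deviation Var_rho *)
Definition qvariance (A : operator) : R[i] :=
  qexpectation (oproduct A A) - qexpectation A ^+ 2.

Definition qcov (A B : operator) : R[i] :=
  qexpectation (oproduct A B) - qexpectation A * qexpectation B.

Definition qcovsym (A B : operator) : R[i] := 2^-1 * (qcov A B + qcov B A).

Definition qcovariances_exist (A B : operator) :=
  [/\ qexpectation_exists A, qexpectation_exists B,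
      qexpectation_exists (oproduct A A), qexpectation_exists (oproduct B B) &
      qexpectation_exists (oproduct A B) /\ qexpectation_exists (oproduct B A)].

End expectation.

End operators.

Section tempered.
Context {R : realType}.
Variable m : nat.

(* Partial derivatives and monomials of order k are indexed by sequences of k
   coordinates rather than by multi-indices. *)
Definition dpart (s : seq 'I_m) (f : 'rV[R]_m -> R) : 'rV[R]_m -> R :=
  foldr (fun i (g : 'rV[R]_m -> R) x => 'D_(delta_mx 0 i) g x) f s.

Definition monomial (t : seq 'I_m) (x : 'rV[R]_m) : R := \prod_(i <- t) x 0 i.

Definition real_schwartz (f : 'rV[R]_m -> R) :=
  (forall s x, differentiable (dpart s f) x) /\
  (forall s t, exists M : R, forall x, `|monomial t x * dpart s f x| <= M).

Definition schwartz (f : 'rV[R]_m -> R[i]) :=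
  real_schwartz (fun x => Re (f x)) /\ real_schwartz (fun x => Im (f x)).

Definition seminorms_le (N : nat) (f : 'rV[R]_m -> R[i]) (M : R) :=
  forall s t, (size s <= N)%N -> (size t <= N)%N -> forall x,
    `|monomial t x * dpart s (fun y => Re (f y)) x| <= M /\
    `|monomial t x * dpart s (fun y => Im (f y)) x| <= M.

(* A distribution is a total function of which only the values on Schwartz
   functions are meaningful; continuity is the usual seminorm estimate. *)
Definition tempered (a : ('rV[R]_m -> R[i]) -> R[i]) :=
  (forall (c : R[i]) f g, schwartz f -> schwartz g ->
     a (fun x => c * f x + g x) = c * a f + a g) /\
  (exists (N : nat) (K : R), forall f M, schwartz f ->
     seminorms_le N f M -> `|a f| <= (K * M)%:C).

Definition real_distribution (a : ('rV[R]_m -> R[i]) -> R[i]) :=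
  forall f, schwartz f -> (forall x, Im (f x) = 0) -> Im (a f) = 0.

End tempered.

(* A point z = (x, p) of phase space is a vector of R^(n + n). *)

Section quantization.
Context {R : realType}.
Variables (n : nat) (hbar : R).

Definition expi (t : R) : R[i] := cos t +i* sin t.

Definition dotp (x y : 'rV[R]_n) : R := \sum_(i < n) x 0 i * y 0 i.

Definition xpart (z : 'rV[R]_(n + n)) : 'rV[R]_n := lsubmx z.
Definition ppart (z : 'rV[R]_(n + n)) : 'rV[R]_n := rsubmx z.

Definition planck_factor : R[i] := (((2 * pi * hbar) ^+ n)^-1)%:C.

(* The symplectic Fourier transform of a distribution, by duality:
   <a_sigma, F> = <a, z' |-> (2 pi hbar)^-n
                     int e^(-(i/hbar)(p.x' - p'.x)) F(z) dz>. *)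
Definition symplectic_fourier (a : ('rV[R]_(n + n) -> R[i]) -> R[i])
    (F : 'rV[R]_(n + n) -> R[i]) : R[i] :=
  a (fun z' => planck_factor * cintegral (fun z =>
    expi (- hbar^-1 * (dotp (ppart z) (xpart z') - dotp (ppart z') (xpart z))) * F z)).

Definition heisenberg_weyl (z0 : 'rV[R]_(n + n)) (psi : 'rV[R]_n -> R[i])
    (x : 'rV[R]_n) : R[i] :=
  expi (hbar^-1 * (dotp (ppart z0) x - 2^-1 * dotp (ppart z0) (xpart z0)))
  * psi (x - xpart z0).

Inductive correspondence := Weyl | BornJordan.

Definition Theta (z : 'rV[R]_(n + n)) : R :=
  let u := dotp (ppart z) (xpart z) / (2 * hbar) in
  if u == 0 then 1 else sin u / u.

Definition multiplier (q : correspondence) (z : 'rV[R]_(n + n)) : R :=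
  match q with Weyl => 1 | BornJordan => Theta z end.

(* For psi and phi Schwartz, the bilinear pairing of the tempered distribution
   Op(a) psi = (2 pi hbar)^-n int a_sigma(z) T(z) psi dz with phi
   (a_sigma being replaced by a_sigma Theta in the Born-Jordan case); the
   integral is the action of a_sigma on the Schwartz function
   z |-> int (T(z) psi)(x) phi(x) dx. *)
Definition Op (q : correspondence) (a : ('rV[R]_(n + n) -> R[i]) -> R[i])
    (psi phi : 'rV[R]_n -> R[i]) : R[i] :=
  planck_factor * symplectic_fourier a (fun z => (multiplier q z)%:C *
    cintegral (fun x => heisenberg_weyl z psi x * phi x)).

(* A is an (essentially) self-adjoint realization of Op(a): for a Schwartz
   function psi in the domain of A, the distribution Op(a) psi is the function
   A psi of L^2; such psi are dense. The domain is otherwise left free, so as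
   to allow for the closure of Op(a) as well as for any core. *)
Definition observable (q : correspondence)
    (a : ('rV[R]_(n + n) -> R[i]) -> R[i]) (A : operator n) :=
  [/\ tempered a, real_distribution a, essentially_self_adjoint A,
      L2dense (dom A `&` @schwartz R n) &
      forall psi phi, schwartz psi -> dom A psi -> schwartz phi ->
        Op q a psi phi = cintegral (fun x => act A psi x * phi x)].

End quantization.

(* Main.v *)
(* By symmetry of A and B, each expectation value is a weighted sum of inner
   products of the vectors A psi_j, B psi_j, psi_j (e.g. <AB> is the sum of the
   lam_j (B psi_j | A psi_j)). Summing the nonnegative numbers
   lam_j ||x A psi_j + y B psi_j + z psi_j||^2 and choosing z = - x <A> - y <B>
   yields a nonnegative form in x real and y complex with coefficients the
   variances and the covariance Cov(B, A); its discriminant gives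
   |Cov(B, A)|^2 <= Var(A)^2 Var(B)^2. The symmetrized covariance and
   <[A, B]> are the real part of Cov(B, A) and - 2 i times its imaginary part. *)
Require Import Defs.
From HB Require Import structures.
From mathcomp Require Import all_boot all_order all_algebra.
From mathcomp Require Import complex.
From mathcomp Require Import all_classical all_reals all_analysis.
From mathcomp Require Import ring lra.

Import Order.TTheory GRing.Theory Num.Theory.
Import numFieldNormedType.Exports.

Local Open Scope ring_scope.
Local Open Scope complex_scope.

Set Implicit Arguments.
Unset Strict Implicit.

(** * Complex limits and series through real and imaginary parts *)

Lemma normc_ge_Im {R : rcfType} (z : R[i]) : `|complex.Im z|%:C <= `|z|.
Proof.
rewrite normc_def lecR -[leLHS]sqrtr_sqr; apply: ler_wsqrtr.
by rewrite lerDr sqr_ge0.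
Qed.

Lemma normc_le_Re_Im {R : rcfType} (z : R[i]) :
  `|z| <= (`|complex.Re z| + `|complex.Im z|)%:C.
Proof.
rewrite normc_def lecR -[leRHS]ger0_norm ?addr_ge0// -[leRHS]sqrtr_sqr.
apply: ler_wsqrtr; rewrite sqrrD !real_normK ?num_real// addrAC lerDl.
by rewrite mulrn_wge0// mulr_ge0.
Qed.

Section complex_limits.
Context {R : realType}.
Implicit Types (z : R[i]) (u : nat -> R[i]^o).

Lemma cvg_complexP u z : (u @ \oo --> (z : R[i]^o))%classic <->
  ((fun k => complex.Re (u k)) @ \oo --> complex.Re z)%classic /\
  ((fun k => complex.Im (u k)) @ \oo --> complex.Im z)%classic.
Proof.
split=> [/cvgrPdist_lt uz|[/cvgrPdist_lt uzR /cvgrPdist_lt uzI]].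
  split; apply/cvgrPdist_lt => e e0; have e0C : 0 < e%:C :> R[i] by rewrite ltcR.
    apply: filterS (uz _ e0C) => k; rewrite -raddfB -ltcR.
    exact/le_lt_trans/normc_ge_Re.
  apply: filterS (uz _ e0C) => k; rewrite -raddfB -ltcR.
  exact/le_lt_trans/normc_ge_Im.
(* The norm of [R[i]] takes its values in [R[i]], and so does the radius: its positivity forces the
   imaginary part [e'] to vanish. *)
apply/cvgrPdist_lt => -[e e'] /=; rewrite ltcE/= => /andP[/eqP-> e0].
have e20 : 0 < e / 2 by rewrite divr_gt0.
apply: filterS2 (uzR _ e20) (uzI _ e20) => k; rewrite -!raddfB/= => uR uI.
apply: le_lt_trans (normc_le_Re_Im _) _.
by rewrite ltcR [e in ltRHS]splitr ltrD.
Qed.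

Lemma Re_series u :
  (fun k => complex.Re (series u k)) = series (fun j => complex.Re (u j)).
Proof. by apply/funext => k; exact: raddf_sum. Qed.

Lemma Im_series u :
  (fun k => complex.Im (series u k)) = series (fun j => complex.Im (u j)).
Proof. by apply/funext => k; exact: raddf_sum. Qed.

(** The real and the imaginary parts of the terms are dominated by the modulus, so both real series
    converge absolutely. *)
Lemma normed_series_cvgc u : cvgn [normed series u] -> cvgn (series u).
Proof.
move=> /cvg_ex[l ul].
have [ulR _] := (cvg_complexP (fun k => [normed series u] k) l).1 ul.
have uR : cvgn (series (fun j => complex.Re (`|u j| : R[i]))).
  by rewrite -Re_series; apply/cvg_ex; exists (complex.Re l).
have dom (f : R[i] -> R) : (forall z, `|f z|%:C <= `|z|) ->
    cvgn (series (fun j => f (u j))).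
  move=> fle; apply: normed_cvg; apply: series_le_cvg uR => j /=; first exact: normr_ge0.
    by have : 0 <= (`|u j| : R[i]) by []; rewrite lecE => /andP[].
  by have := fle (u j); rewrite lecE => /andP[_].
have /cvg_ex[a ua] := dom (@complex.Re R) (@normc_ge_Re _).
have /cvg_ex[b ub] := dom (@complex.Im R) (@normc_ge_Im _).
apply/cvg_ex; exists (a +i* b : R[i]^o); apply/cvg_complexP.
by rewrite Re_series Im_series.
Qed.

End complex_limits.

(** * The inner product of L^2(R^n) and symmetric operators *)

Section inner_product.
Context {R : realType}.
Variable n : nat.
Implicit Types (f g h : 'rV[R]_n -> R[i]) (c : R[i]).

(** Integrability of both parts ensures that the two real integrals in [cintegral] are genuine and
    additive. *)
Definition cintegrable f :=
  (lebesgue_rV n).-integrable [set: 'rV[R]_n] (EFin \o (fun x => complex.Re (f x))) /\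
  (lebesgue_rV n).-integrable [set: 'rV[R]_n] (EFin \o (fun x => complex.Im (f x))).

Lemma cintegral_linear c f g : cintegrable f -> cintegrable g ->
  cintegral (fun x => c * f x + g x) = c * cintegral f + cintegral g.
Proof.
case: c => a b [fR fI] [gR gI].
have iZ (k : R) (u : 'rV[R]_n -> R) :
    (lebesgue_rV n).-integrable setT (EFin \o u) ->
    (lebesgue_rV n).-integrable setT (EFin \o (fun x => k * u x)).
  by move=> iu; exact: (integrableZl measurableT k iu).
have iD (u v : 'rV[R]_n -> R) :
    (lebesgue_rV n).-integrable setT (EFin \o u) ->
    (lebesgue_rV n).-integrable setT (EFin \o v) ->
    (lebesgue_rV n).-integrable setT (EFin \o (fun x => u x + v x)).
  by move=> iu iv; exact: (integrableD measurableT iu iv).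
have ReE x : complex.Re ((a +i* b) * f x + g x) =
    a * complex.Re (f x) + - b * complex.Im (f x) + complex.Re (g x).
  by case: (f x) (g x) => [? ?] [? ?] /=; rewrite mulNr.
have ImE x : complex.Im ((a +i* b) * f x + g x) =
    a * complex.Im (f x) + b * complex.Re (f x) + complex.Im (g x).
  by case: (f x) (g x) => [? ?] [? ?] /=.
rewrite /cintegral (eq_Rintegral _ (fun x _ => ReE x)).
rewrite (eq_Rintegral _ (fun x _ => ImE x)).
rewrite !RintegralD ?RintegralZl//; try by [apply: iZ|apply: iD; exact: iZ].
by rewrite mulNr; apply/eqP; rewrite eq_complex/= !eqxx.
Qed.

Lemma cintegral_conj f : cintegrable f ->
  cintegral (fun x => (f x)^*) = (cintegral f)^*.
Proof.
move=> [fR fI]; rewrite /cintegral/=; congr (_ +i* _).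
  by apply: eq_Rintegral => x _; case: (f x).
rewrite -mulN1r -RintegralZl//; apply: eq_Rintegral => x _.
by case: (f x) => ? ?; rewrite mulN1r.
Qed.

Lemma L2_linear c f g : L2 f -> L2 g -> L2 (fun x => c * f x + g x).
Proof.
have p1 : (1 <= 2%:E :> \bar R)%E by rewrite lee_fin ler1n.
have LD (u v : 'rV[R]_n -> R) : u \in Lfun (lebesgue_rV n) 2%:E ->
    v \in Lfun (lebesgue_rV n) 2%:E ->
    (fun x => u x + v x) \in Lfun (lebesgue_rV n) 2%:E.
  by move=> uL vL; exact: (Lfun_addr_closed (lebesgue_rV n) p1).2.
have LZ (k : R) (u : 'rV[R]_n -> R) : u \in Lfun (lebesgue_rV n) 2%:E ->
    (fun x => k * u x) \in Lfun (lebesgue_rV n) 2%:E.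
  move=> uL; rewrite (_ : (fun x => _) = k \o* u).
    exact: Lfun_scale (ler1n _ 2) uL.
  by apply/funext => x; rewrite /= mulrC.
case: c => a b [fR fI] [gR gI]; split.
  rewrite (_ : (fun x => _) = (fun x =>
    a * complex.Re (f x) + - b * complex.Im (f x) + complex.Re (g x))).
    by apply: (LD _ _ _ gR); apply: LD; exact: LZ.
  apply/funext => x.
  by case: (f x) (g x) => [? ?] [? ?] /=; rewrite mulNr.
rewrite (_ : (fun x => _) = (fun x =>
  a * complex.Im (f x) + b * complex.Re (f x) + complex.Im (g x))).
  by apply: (LD _ _ _ gI); apply: LD; exact: LZ.
by apply/funext => x; case: (f x) (g x) => [? ?] [? ?].
Qed.

(** Each part of the integrand is a sum or difference of products of two real square-integrable
    functions, which are integrable by Hölder's inequality. *)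
Lemma cintegrable_inner f g : L2 f -> L2 g -> cintegrable (fun x => f x * (g x)^*).
Proof.
move=> [fR fI] [gR gI].
have iM (u v : 'rV[R]_n -> R) : u \in Lfun (lebesgue_rV n) 2%:E ->
    v \in Lfun (lebesgue_rV n) 2%:E ->
    (lebesgue_rV n).-integrable setT (EFin \o (fun x => u x * v x)).
  by move=> uL vL; apply/Lfun1_integrable; exact: Lfun2_mul_Lfun1.
split.
  rewrite (_ : EFin \o _ =
    ((EFin \o (fun x => (complex.Re (f x) * complex.Re (g x))%R))
    \+ (EFin \o (fun x => (complex.Im (f x) * complex.Im (g x))%R)))%E).
    by apply: integrableD => //; exact: iM.
  apply/funext => x /=; rewrite -EFinD; congr EFin.
  by case: (f x) (g x) => [? ?] [? ?] /=; rewrite mulrN opprK.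
rewrite (_ : EFin \o _ =
  ((EFin \o (fun x => (complex.Im (f x) * complex.Re (g x))%R))
  \- (EFin \o (fun x => (complex.Re (f x) * complex.Im (g x))%R)))%E).
  by apply: integrableB => //; exact: iM.
apply/funext => x /=; rewrite -EFinB; congr EFin.
by case: (f x) (g x) => [? ?] [? ?] /=; rewrite mulrN addrC.
Qed.

Lemma inner_linear c f g h : L2 f -> L2 g -> L2 h ->
  inner (fun x => c * f x + g x) h = c * inner f h + inner g h.
Proof.
move=> fL gL hL; rewrite -cintegral_linear; try exact: cintegrable_inner.
by congr cintegral; apply/funext => x; rewrite mulrDl mulrA.
Qed.

Lemma inner_conj f g : L2 f -> L2 g -> inner g f = (inner f g)^*.
Proof.
move=> fL gL; rewrite -cintegral_conj; last exact: cintegrable_inner.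
congr cintegral; apply/funext => x.
by rewrite rmorphM/= conjcK mulrC.
Qed.

Lemma inner_ge0 f : 0 <= inner f f.
Proof.
have Im0 x : complex.Im (f x * (f x)^*) = 0.
  by case: (f x) => p q /=; ring.
rewrite lecE /=; apply/andP; split; last first.
  apply: Rintegral_ge0 => x _; case: (f x) => p q /=.
  by rewrite mulrN opprK addr_ge0// -expr2 sqr_ge0.
rewrite (eq_Rintegral _ (fun x _ => Im0 x)).
by rewrite Rintegral_cst// mul0r.
Qed.

Lemma inner_linearr c f g h : L2 f -> L2 g -> L2 h ->
  inner h (fun x => c * f x + g x) = c^* * inner h f + inner h g.
Proof.
move=> fL gL hL; have fgL := L2_linear c fL gL.
rewrite (inner_conj fgL hL) inner_linear// rmorphD rmorphM.
by rewrite (inner_conj fL hL) (inner_conj gL hL).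
Qed.

Lemma L2Z c f : L2 f -> L2 (fun x => c * f x).
Proof.
move=> fL; have := L2_linear (c - 1) fL fL; congr L2.
by apply/funext => x; rewrite mulrBl mul1r subrK.
Qed.

Lemma innerZ c f g : L2 f -> L2 g -> inner (fun x => c * f x) g = c * inner f g.
Proof.
move=> fL gL; rewrite -[c in RHS](subrK 1) mulrDl mul1r -inner_linear//.
by congr (inner _ g); apply/funext => x; rewrite mulrBl mul1r subrK.
Qed.

Lemma innerB f g h : L2 f -> L2 g -> L2 h ->
  inner (f \- g) h = inner f h - inner g h.
Proof.
move=> fL gL hL; rewrite addrC -mulN1r -inner_linear//.
by congr (inner _ h); apply/funext => x /=; rewrite mulN1r addrC.
Qed.

Lemma Im_inner f : complex.Im (inner f f) = 0.
Proof. by have := inner_ge0 f; rewrite lecE => /andP[/eqP]. Qed.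

Lemma L2norm_subrr f : L2norm (f \- f) = 0.
Proof.
rewrite /L2norm /inner /cintegral/=.
have Re0 x : complex.Re ((f \- f) x * ((f \- f) x)^*) = 0.
  by rewrite /= subrr mul0r.
by rewrite (eq_Rintegral _ (fun x _ => Re0 x)) Rintegral_cst// mul0r sqrtr0.
Qed.

(** This is the expansion of ||x f + y g + z h||^2 with x real, y = y1 + i y2 and z = z1 + i z2.
    Every summand is a real constant times the real or imaginary part of one inner product, so the
    inequality can later be summed over j term by term. *)
Lemma gram_ge0 f g h (x y1 y2 z1 z2 : R) : L2 f -> L2 g -> L2 h ->
  0 <= x ^+ 2 * complex.Re (inner f f) +
       ((y1 ^+ 2 + y2 ^+ 2) * complex.Re (inner g g) +
       ((z1 ^+ 2 + z2 ^+ 2) * complex.Re (inner h h) +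
       (2 * x * y1 * complex.Re (inner f g) +
       (2 * x * y2 * complex.Im (inner f g) +
       (2 * x * z1 * complex.Re (inner f h) +
       (2 * x * z2 * complex.Im (inner f h) +
       (2 * (y1 * z1 + y2 * z2) * complex.Re (inner g h) +
       2 * (y1 * z2 - y2 * z1) * complex.Im (inner g h)))))))).
Proof.
move=> fL gL hL; pose v t := (y1 +i* y2) * g t + (z1 +i* z2) * h t.
have zL := L2Z (z1 +i* z2) hL; have vL : L2 v := L2_linear (y1 +i* y2) gL zL.
have uL := L2_linear x%:C fL vL.
have innerv k : L2 k ->
    inner v k = (y1 +i* y2) * inner g k + (z1 +i* z2) * inner h k.
  by move=> kL; rewrite inner_linear// innerZ.
have innervr k : L2 k ->
    inner k v = (y1 +i* y2)^* * inner k g + (z1 +i* z2)^* * inner k h.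
  move=> kL; rewrite (inner_conj vL kL) innerv// rmorphD !rmorphM.
  by rewrite (inner_conj gL kL) (inner_conj hL kL).
(* The body of [v] = y g + z h is forgotten, so that [v] is expanded only through [innerv] and
   [innervr]. *)
clearbody v; have := inner_ge0 (fun t => x%:C * f t + v t).
rewrite lecE => /andP[_]; rewrite inner_linear// !inner_linearr//.
rewrite !innerv// !innervr//.
rewrite (inner_conj fL gL) (inner_conj fL hL) (inner_conj gL hL).
move: (Im_inner f) (Im_inner g) (Im_inner h).
case: (inner f f) (inner g g) (inner h h) => [a ?] [b ?] [c ?] /= -> -> ->.
case: (inner f g) (inner f h) (inner g h) => [? ?] [? ?] [? ?] /=.
by congr (0 <= _); ring.
Qed.

End inner_product.

(** The pairs (f, A f) and (g, A g) lie in the closed graph, which is its own adjoint; the adjoint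
    relation between these two pairs is the symmetry. *)
Lemma essentially_self_adjoint_symmetric (R : realType) n (A : operator n)
    (f g : 'rV[R]_n -> R[i]) :
  essentially_self_adjoint A -> dom A f -> dom A g ->
  inner (act A f) g = inner f (act A g).
Proof.
move=> [[domL2 actL2 _ _ _] _ Aadj] Af Ag.
have clA k : dom A k -> gclosure (graph A) (k, act A k).
  move=> Ak; split; [exact: domL2|exact: actL2|move=> e e0].
  exists (k, act A k); last by rewrite !L2norm_subrr.
  by split => //=; [exact: actL2|exact: aeW].
by have := clA _ Ag; rewrite Aadj => -[_ _ /(_ _ (clA _ Af))].
Qed.

(** * Sums of real series and the discriminant of a quadratic form *)

Lemma cvg_seriesD {R : realType} {u v : nat -> R} {l m : R} :
  (series u @ \oo --> l -> series v @ \oo --> m ->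
   series (fun j => u j + v j) @ \oo --> l + m)%classic.
Proof.
move=> ul vm; rewrite (_ : series _ = series u \+ series v); first exact: cvgD.
by apply/funext => k; rewrite /series/= big_split.
Qed.

Lemma cvg_seriesZ {R : realType} (c : R) {u : nat -> R} {l : R} :
  (series u @ \oo --> l -> series (fun j => c * u j) @ \oo --> c * l)%classic.
Proof.
move=> ul; rewrite (_ : series _ = (fun k => c * series u k)).
  by apply: cvgM ul; exact: cvg_cst.
by apply/funext => k; rewrite /series/= big_distrr.
Qed.

Lemma cvg_series_ge0 {R : realType} {u : nat -> R} {l : R} :
  (series u @ \oo --> l)%classic -> (forall j, 0 <= u j) -> 0 <= l.
Proof.
move=> ul u0; rewrite -(cvg_lim (@Rhausdorff R) ul); apply: limr_ge.
  by apply/cvg_ex; exists l.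
by apply: nearW => k; exact: sumr_ge0.
Qed.

Lemma quadratic_form_discriminant (R : realFieldType) (X Y r s : R) :
  (forall x y1 y2 : R,
    0 <= x ^+ 2 * X + (y1 ^+ 2 + y2 ^+ 2) * Y + 2 * x * (y1 * r + y2 * s)) ->
  r ^+ 2 + s ^+ 2 <= X * Y.
Proof.
move=> Q; have Y0 : 0 <= Y by have := Q 0 1 0; lra.
have [Yp|] := ltP 0 Y; last first.
  move=> Yn; have {Y0 Yn} YE : Y = 0 by lra.
  rewrite {}YE in Q *.
  (* For Y = 0 the form is affine in (y1, y2). With d = r^2 + s^2, the choice x = d, y = - (X + 1) /
     2 (r, s) gives it the value - d^2, so d = 0. *)
  have := Q (r ^+ 2 + s ^+ 2) (- ((X + 1) / 2) * r) (- ((X + 1) / 2) * s).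
  rewrite !mulr0 addr0; set d := r ^+ 2 + s ^+ 2.
  rewrite (_ : _ * d * _ = - d ^+ 2 * (X + 1)); last by rewrite /d; field.
  move=> dX; have : d ^+ 2 == 0 by rewrite eq_le sqr_ge0 andbT; lra.
  by rewrite sqrf_eq0 => /eqP->.
(* At the minimizer in y for x = Y, namely y = - (r, s), the form equals Y (X Y - r^2 - s^2). *)
rewrite -subr_ge0 -(pmulr_rge0 _ Yp); have := Q Y (- r) (- s).
by congr (0 <= _); ring.
Qed.

(** * Expectation values as weighted series *)

Section expectation_values.
Context {R : realType}.
Variables (n : nat) (lam : nat -> R) (psi : nat -> 'rV[R]_n -> R[i]).
Hypothesis lam_ge0 : forall j, 0 <= lam j.
Implicit Types A B C D : @operator R n.
Local Notation term := (qexpectation_term lam psi).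
Local Notation exists_E := (qexpectation_exists lam psi).
Local Notation E := (qexpectation lam psi).

(** Existence includes absolute convergence, so the [limn] defining the expectation value is a true
    limit. *)
Lemma cvg_qexpectation C : exists_E C ->
  (series (fun j => complex.Re (term C j)) @ \oo --> complex.Re (E C))%classic /\
  (series (fun j => complex.Im (term C j)) @ \oo --> complex.Im (E C))%classic.
Proof.
move=> [_ /normed_series_cvgc /cvg_complexP[cR cI]].
by rewrite -Re_series -Im_series.
Qed.

Lemma qexpectation_eq (z : R[i]) C :
  (series (fun j => complex.Re (term C j)) @ \oo --> complex.Re z)%classic ->
  (series (fun j => complex.Im (term C j)) @ \oo --> complex.Im z)%classic ->
  E C = z.
Proof.
move=> zR zI; apply: (cvg_lim (@norm_hausdorff _ R[i]^o)).
by apply/cvg_complexP; rewrite Re_series Im_series.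
Qed.

Lemma qexpectation_conj C D : exists_E C ->
  (forall j, term D j = (term C j)^*) -> E D = (E C)^*.
Proof.
move=> /cvg_qexpectation[cR cI] DC; apply: qexpectation_eq.
  rewrite (_ : (fun j => _) = (fun j => complex.Re (term C j))).
    by move: cR; case: (E C).
  by apply/funext => j; rewrite DC; case: (term C j).
rewrite (_ : (fun j => _) = (fun j => -1 * complex.Im (term C j))).
  by move: (cvg_seriesZ (c := -1) cI); rewrite mulN1r; case: (E C).
by apply/funext => j; rewrite DC mulN1r; case: (term C j).
Qed.

(** Where [lam j] = 0 the vector [psi j] may lie outside the domain and [act C (psi j)] is
    meaningless, but the zero weight removes the term. *)
Lemma qexpectation_termE C j (z : R[i]) :
  (0 < lam j -> inner (act C (psi j)) (psi j) = z) ->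
  term C j = (lam j)%:C * z.
Proof.
move=> Cz; rewrite /qexpectation_term; have := lam_ge0 j.
by rewrite le_eqVlt => /predU1P[<-|/Cz->//]; rewrite !mul0r.
Qed.

(** Since [act B (psi j)] is in the domain of A, symmetry moves A to the second argument; only first
    powers of A and B remain. *)
Lemma qexpectation_term_oproduct A B j : essentially_self_adjoint A ->
  exists_E A -> exists_E (oproduct A B) ->
  term (oproduct A B) j =
    (lam j)%:C * inner (act B (psi j)) (act A (psi j)).
Proof.
move=> Asa [domA _] [domAB _]; apply: qexpectation_termE => lj.
have [_ AB] := domAB _ lj.
exact: (essentially_self_adjoint_symmetric Asa AB (domA _ lj)).
Qed.

Lemma Im_qexpectation A : essentially_self_adjoint A -> exists_E A ->
  complex.Im (E A) = 0.
Proof.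
move=> Asa EA; have [[domL2 actL2 _ _ _] _ _] := Asa.
(* By symmetry of A, every term of the series is its own conjugate. *)
suff : E A = (E A)^* by case: (E A) => p q [] /=; lra.
apply: qexpectation_conj => // j; rewrite [in RHS]/qexpectation_term rmorphM.
rewrite (qexpectation_termE (z := (inner (act A (psi j)) (psi j))^*)).
  by congr (_ * _); rewrite /= oppr0.
move=> /(EA.1 _) Aj; rewrite [LHS](essentially_self_adjoint_symmetric Asa Aj Aj).
by apply: inner_conj; [exact: actL2|exact: domL2].
Qed.

(** * Products, commutator and covariance of two observables *)

Section two_observables.
Variables A B : @operator R n.
Hypotheses (Asa : essentially_self_adjoint A) (Bsa : essentially_self_adjoint B).
Hypotheses (EA : exists_E A) (EB : exists_E B).
Hypotheses (EAB : exists_E (oproduct A B)) (EBA : exists_E (oproduct B A)).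

(** Termwise, the two sides involve (B psi_j | A psi_j) and the conjugate of (A psi_j | B psi_j). *)
Lemma qexpectation_oproduct_conj : E (oproduct A B) = (E (oproduct B A))^*.
Proof.
have [[_ actL2A _ _ _] _ _] := Asa; have [[_ actL2B _ _ _] _ _] := Bsa.
apply: qexpectation_conj => // j; rewrite (qexpectation_term_oproduct _ Bsa)//.
rewrite rmorphM; rewrite (qexpectation_termE
  (z := (inner (act A (psi j)) (act B (psi j)))^*)).
  by congr (_ * _); rewrite /= oppr0.
move=> lj; have [_ AB] := EAB.1 _ lj.
rewrite (essentially_self_adjoint_symmetric Asa AB (EA.1 _ lj)).
apply: inner_conj; [exact: actL2A (EA.1 _ lj)|exact: actL2B (EB.1 _ lj)].
Qed.

Hypothesis psi_L2 : forall j, L2 (psi j).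

Lemma qexpectation_commutator :
  E (commutator A B) = E (oproduct A B) - E (oproduct B A).
Proof.
have [[_ actL2A _ _ _] _ _] := Asa; have [[_ actL2B _ _ _] _ _] := Bsa.
have termB j : term (commutator A B) j =
    term (oproduct A B) j - term (oproduct B A) j.
  rewrite -mulrBr; apply: qexpectation_termE => lj.
  have [_ AB] := EAB.1 _ lj; have [_ BA] := EBA.1 _ lj.
  by rewrite innerB//; [exact: actL2A|exact: actL2B].
have [ABR ABI] := cvg_qexpectation EAB.
have [BAR BAI] := cvg_qexpectation EBA.
(* The commutator series converges as the difference of the two product series. *)
apply: qexpectation_eq.
  rewrite raddfB -mulN1r (_ : (fun j => _) = (fun j =>
    complex.Re (term (oproduct A B) j) +
    -1 * complex.Re (term (oproduct B A) j))).
    exact: cvg_seriesD ABR (cvg_seriesZ BAR).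
  by apply/funext => j; rewrite termB raddfB mulN1r.
rewrite raddfB -mulN1r (_ : (fun j => _) = (fun j =>
  complex.Im (term (oproduct A B) j) +
  -1 * complex.Im (term (oproduct B A) j))).
  exact: cvg_seriesD ABI (cvg_seriesZ BAI).
by apply/funext => j; rewrite termB raddfB mulN1r.
Qed.

Hypothesis psi_normed : forall j, inner (psi j) (psi j) = 1.
Hypothesis lam_sum : (series lam @ \oo --> (1 : R))%classic.
Hypotheses (EAA : exists_E (oproduct A A)) (EBB : exists_E (oproduct B B)).

(** The inequality [gram_ge0] for the vectors A psi_j, B psi_j, psi_j is multiplied by [lam j] and
    summed; the coefficient 1 is the sum of the weights. *)
Lemma covariance_form_ge0 (x y1 y2 z1 z2 : R) :
  0 <= x ^+ 2 * complex.Re (E (oproduct A A)) +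
       ((y1 ^+ 2 + y2 ^+ 2) * complex.Re (E (oproduct B B)) +
       ((z1 ^+ 2 + z2 ^+ 2) * 1 +
       (2 * x * y1 * complex.Re (E (oproduct B A)) +
       (2 * x * y2 * complex.Im (E (oproduct B A)) +
       (2 * x * z1 * complex.Re (E A) +
       (2 * x * z2 * complex.Im (E A) +
       (2 * (y1 * z1 + y2 * z2) * complex.Re (E B) +
       2 * (y1 * z2 - y2 * z1) * complex.Im (E B)))))))).
Proof.
have [AAR _] := cvg_qexpectation EAA; have [BBR _] := cvg_qexpectation EBB.
have [BAR BAI] := cvg_qexpectation EBA.
have [AR AI] := cvg_qexpectation EA; have [BR BI] := cvg_qexpectation EB.
(* The nesting of the nine series follows that of the statement, leaving one inequality for each
   j. *)
apply: (cvg_series_ge0 (cvg_seriesD (cvg_seriesZ AAR)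
  (cvg_seriesD (cvg_seriesZ BBR) (cvg_seriesD (cvg_seriesZ lam_sum)
  (cvg_seriesD (cvg_seriesZ BAR) (cvg_seriesD (cvg_seriesZ BAI)
  (cvg_seriesD (cvg_seriesZ AR) (cvg_seriesD (cvg_seriesZ AI)
  (cvg_seriesD (cvg_seriesZ BR) (cvg_seriesZ BI)))))))))) => j.
rewrite !qexpectation_term_oproduct// /qexpectation_term.
have ReZ (k : R) (z : R[i]) : complex.Re (k%:C * z) = k * complex.Re z.
  by case: z => ? ? /=; rewrite mul0r subr0.
have ImZ (k : R) (z : R[i]) : complex.Im (k%:C * z) = k * complex.Im z.
  by case: z => ? ? /=; rewrite mul0r addr0.
rewrite !ReZ !ImZ; have := lam_ge0 j; rewrite le_eqVlt => /predU1P[<-|lj].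
  by rewrite !(mul0r, mulr0, addr0).
have [[_ actL2A _ _ _] _ _] := Asa; have [[_ actL2B _ _ _] _ _] := Bsa.
have := gram_ge0 x y1 y2 z1 z2 (actL2A _ (EA.1 _ lj)) (actL2B _ (EB.1 _ lj))
  (psi_L2 j).
rewrite psi_normed -(pmulr_rge0 _ lj); congr (0 <= _) => /=; ring.
Qed.

Lemma Robertson_Schrodinger :
  (complex.Re (E (oproduct B A)) - complex.Re (E A) * complex.Re (E B)) ^+ 2 +
    complex.Im (E (oproduct B A)) ^+ 2 <=
  (complex.Re (E (oproduct A A)) - complex.Re (E A) ^+ 2) *
  (complex.Re (E (oproduct B B)) - complex.Re (E B) ^+ 2).
Proof.
apply: quadratic_form_discriminant => x y1 y2.
(* The choice z = - x <A> - y <B> replaces A and B by A - <A> and B - <B>. As <A> and <B> are real,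
   it affects only the real part of the mixed coefficient. *)
have := covariance_form_ge0 x y1 y2
  (- (x * complex.Re (E A) + y1 * complex.Re (E B))) (- y2 * complex.Re (E B)).
have := Im_qexpectation Bsa EB; have := Im_qexpectation Asa EA.
generalize (E A) (E B) (E (oproduct A A)) (E (oproduct B B)) (E (oproduct B A)).
by move=> [? ?] [? ?] [? ?] [? ?] [? ?] /= -> ->; congr (0 <= _); ring.
Qed.

End two_observables.

End expectation_values.

(** * The uncertainty inequalities in their complex form *)

Unset Implicit Arguments.

Theorem proposition12 (R : realType) (n : nat) (hbar : R) (q : correspondence)
  (rho : operator n) (lam : nat -> R) (psi : nat -> 'rV[R]_n -> R[i])
  (a b : ('rV[R]_(n + n) -> R[i]) -> R[i]) (A B : operator n)
  (n_gt0 : (0 < n)%N) (hbar_gt0 : 0 < hbar)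
  (rho_density : density_matrix rho)
  (rho_spectral : spectral_decomposition rho lam psi)
  (A_observable : observable hbar q a A)
  (B_observable : observable hbar q b B)
  (AB_covariances : qcovariances_exist lam psi A B) :
  [/\ qcovsym lam psi A B ^+ 2
        - 4^-1 * qexpectation lam psi (commutator A B) ^+ 2
        <= qvariance lam psi A * qvariance lam psi B,
      qexpectation lam psi (commutator A B) ^+ 2 <= 0,
      qcovsym lam psi A B \is Num.real &
      - 4^-1 * qexpectation lam psi (commutator A B) ^+ 2
        <= qvariance lam psi A * qvariance lam psi B].
Proof.
have [_ _ Asa _ _] := A_observable; have [_ _ Bsa _ _] := B_observable.
have [lam_ge0 lam_sum [psiL2 psi_orth] _] := rho_spectral.
have [EA EB EAA EBB [EAB EBA]] := AB_covariances.
have psi1 j : inner (psi j) (psi j) = 1 by rewrite psi_orth eqxx.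
have := Robertson_Schrodinger lam_ge0 Asa Bsa EA EB EBA psiL2 psi1 lam_sum
  EAA EBB.
rewrite /qcovsym /qvariance /qcov.
(* The commutator and the product AB are eliminated, so that all mixed terms depend on <BA> = r + i
   s alone. *)
rewrite (qexpectation_commutator lam_ge0 Asa Bsa EAB EBA psiL2).
rewrite (qexpectation_oproduct_conj lam_ge0 Asa Bsa EA EB EAB EBA).
move: (Im_qexpectation lam_ge0 Asa EA).
move: (Im_qexpectation lam_ge0 Bsa EB).
(* The conjugation rule for a pair of equal observables shows that <A^2> and <B^2> are real. *)
have := congr1 (@complex.Im R)
  (qexpectation_oproduct_conj lam_ge0 Asa Asa EA EA EAA EAA).
have := congr1 (@complex.Im R)
  (qexpectation_oproduct_conj lam_ge0 Bsa Bsa EB EB EBB EBB).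
generalize (qexpectation lam psi A) (qexpectation lam psi B)
  (qexpectation lam psi (oproduct A A)) (qexpectation lam psi (oproduct B B))
  (qexpectation lam psi (oproduct B A)).
move=> [eA ?] [eB ?] [eAA iAA] [eBB iBB] [r s] /=.
move=> iBB0 iAA0 -> ->; have {iAA0}-> : iAA = 0 by lra.
have {iBB0}-> : iBB = 0 by lra.
move=> RS.
have -> : 2^-1 * (((r +i* s)^* - (eA +i* 0) * (eB +i* 0)) +
    ((r +i* s) - (eB +i* 0) * (eA +i* 0))) = (r - eA * eB)%:C :> R[i].
  have -> : 2^-1 = (2^-1)%:C :> R[i] by rewrite fmorphV rmorph_nat.
  by apply/eqP; rewrite eq_complex /=; apply/andP; split; apply/eqP; field.
(* Here <[A, B]> = - 2 i s, whose square is real and nonpositive. *)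
have -> : ((r +i* s)^* - (r +i* s)) ^+ 2 = (- 4 * s ^+ 2)%:C :> R[i].
  by rewrite expr2; apply/eqP; rewrite eq_complex /=; apply/andP; split;
    apply/eqP; ring.
have varE (e v : R) : (v +i* 0) - (e +i* 0) ^+ 2 = (v - e ^+ 2)%:C :> R[i].
  by rewrite expr2; apply/eqP; rewrite eq_complex /=; apply/andP; split;
    apply/eqP; ring.
have scaleE : - 4^-1 * (- 4 * s ^+ 2)%:C = (s ^+ 2)%:C :> R[i].
  have -> : 4^-1 = (4^-1)%:C :> R[i] by rewrite fmorphV rmorph_nat.
  by apply/eqP; rewrite eq_complex /=; apply/andP; split; apply/eqP; field.
have sqrE (t : R) : t%:C ^+ 2 = (t ^+ 2)%:C by rewrite rmorphXn.
have varM (u v : R) : u%:C * v%:C = (u * v)%:C by rewrite rmorphM.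
(* The subtraction of 4^-1 times the square is rewritten as multiplication by - 4^-1, so that
   [scaleE] turns both inequalities into statements with s^2. *)
rewrite !varE varM -[- (4^-1 * _)]mulNr scaleE sqrE; split.
- by rewrite -rmorphD lecR.
- by rewrite lecR mulNr oppr_le0 mulr_ge0// sqr_ge0.
- by rewrite realE !lecR -realE num_real.
(* The Heisenberg inequality follows by dropping the square of the symmetrized covariance. *)
- by rewrite lecR; apply: le_trans RS; rewrite lerDr sqr_ge0.
Qed.
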